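(* For all positive integers $a,b,k$, the polynomial $$(1+z^a)(1+z^b)\prod_{j=0}^{k}\left(1+z^{2^j(a+b)}\right)+1$$ is an integer expanding polynomial with leading coefficient $1$ and free term $\pm2$.
   Context: A polynomial is called expanding if all its complex roots have modulus strictly greater than $1$. An integer polynomial is a polynomial with integer coefficients. *)

(* Defs.v *)
From mathcomp Require Import all_boot all_order all_algebra.
From mathcomp Require Import reals complex.

Set Implicit Arguments.
Unset Strict Implicit.
Unset Printing Implicit Defensive.

Import Order.TTheory GRing.Theory Num.Theory.
Local Open Scope ring_scope.
Local Open Scope complex_scope.

(* [Num.int] is not available here, as R[i] has no archimedean instance. *)
Definition integer_poly (R : realType) (p : {poly R[i]}) : Prop :=
  forall i : nat, exists m : int, p`_i = m%:~R.

(* The norm of R[i] takes values in R[i]; there [1 < `|z|] amounts to the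
   comparison of the real modulus of z with 1. *)
Definition expanding (R : realType) (p : {poly R[i]}) : Prop :=
  forall z : R[i], root p z -> 1 < `|z|.

(* Main.v *)
(** Suppose [`|z| <= 1] and [P(z) = 0]; put [x = z^a], [y = z^b], [w = x y] and
    [W = w^(2^(k+1))].  The product over [j] telescopes to [(1 - W) / (1 - w)], so
    [(1 + x)(1 + y)(1 - W) = -(1 - x y)], that is
    [2 (1 - W) + (1 - x)/(1 + x) + (1 - y)/(1 + y) = 0].
    All three terms have nonnegative real part, which forces [W = 1], hence
    [w = 1].  Then [y] is the conjugate of [x], and [P(z) - 1] equals
    [2^(k+1) `|1 + x|^2 >= 0], contradicting [P(z) = 0]. *)
Require Import Defs.
From mathcomp Require Import all_boot all_order all_algebra.
From mathcomp Require Import reals complex ring.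

Import Order.TTheory GRing.Theory Num.Theory.
Local Open Scope ring_scope.

Lemma prod_1DX_exp2_telescope (C : comNzRingType) (w : C) (m : nat) :
  (1 - w) * \prod_(0 <= j < m) (1 + w ^+ (2 ^ j)) = 1 - w ^+ (2 ^ m).
Proof.
elim: m => [|m IHm]; first by rewrite big_geq // mulr1 expr1.
by rewrite big_nat_recr //= mulrA IHm expnSr exprM; ring.
Qed.

Section UnitDisk.
Variable C : numClosedFieldType.
Implicit Types x y z w W : C.

Lemma mulC_conj_le1 x : `|x| <= 1 -> 0 <= 1 - x * x^*.
Proof. by move=> x1; rewrite subr_ge0 -normCK expr_le1. Qed.

Lemma mulC_conj_1D_ge0 x : 0 <= (1 + x) * (1 + x^*).
Proof. by have := mul_conjC_ge0 (1 + x); rewrite rmorphD rmorph1. Qed.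

Lemma unit_disk_eq1 x y W :
    `|x| <= 1 -> `|y| <= 1 -> `|W| <= 1 -> 1 + x != 0 -> 1 + y != 0 ->
  (1 + x) * (1 + y) * (1 - W) = - (1 - x * y) -> W = 1.
Proof.
move=> x1 y1 W1 x0 y0 E.
have E' : (1 + x^*) * (1 + y^*) * (1 - W^*) = - (1 - x^* * y^*).
  have := congr1 (fun t => t^*) E.
  by rewrite !(rmorphM, rmorphN, rmorphB, rmorphD, rmorph1).
set A := (1 + x) * (1 + x^*); set B := (1 + y) * (1 + y^*).
have A0 : 0 <= A := mulC_conj_1D_ge0 x.
have B0 : 0 <= B := mulC_conj_1D_ge0 y.
have A_neq0 : A != 0 by rewrite mulf_neq0 // -(rmorph1 Num.conj) -rmorphD conjC_eq0.
have B_neq0 : B != 0 by rewrite mulf_neq0 // -(rmorph1 Num.conj) -rmorphD conjC_eq0.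
have normW : (1 - W) * (1 - W^*) = `|1 - W| ^+ 2 by rewrite normCK rmorphB rmorph1.
have sum0 : A * B * `|1 - W| ^+ 2 + (A * B * (1 - W * W^*)
    + ((1 - x * x^*) * B + (1 - y * y^*) * A)) = 0.
  rewrite -normW /A /B.
  transitivity ((1 + x^*) * (1 + y^*) *
      ((1 + x) * (1 + y) * (1 - W) + (1 - x * y)) + (1 + x) * (1 + y) *
      ((1 + x^*) * (1 + y^*) * (1 - W^*) + (1 - x^* * y^*))); first by ring.
  by rewrite E E' !addNr !mulr0 addr0.
clearbody A B.
move/eqP: sum0; rewrite paddr_eq0; first last.
- by rewrite !addr_ge0 // !(mulr_ge0, mulC_conj_le1).
- by rewrite !mulr_ge0 // exprn_ge0.
case/andP; rewrite !mulf_eq0 (negPf A_neq0) (negPf B_neq0) /= => + _.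
by rewrite orbb normr_eq0 subr_eq0 => /eqP.
Qed.

Lemma mul_1D_ge0 x y :
  `|x| <= 1 -> `|y| <= 1 -> x * y = 1 -> 0 <= (1 + x) * (1 + y).
Proof.
move=> x1 y1 xy1.
have nxy : `|x| * `|y| = 1 by rewrite -normrM xy1 normr1.
have nx : `|x| = 1.
  by apply/le_anti; rewrite x1 -nxy ler_piMr.
have x0 : x != 0 by rewrite -normr_eq0 nx oner_neq0.
have -> : y = x^*.
  by apply: (mulfI x0); rewrite xy1 -normCK nx expr1n.
exact: mulC_conj_1D_ge0.
Qed.

Lemma no_root_in_unit_disk z a b k : `|z| <= 1 ->
  (1 + z ^+ a) * (1 + z ^+ b)
    * (\prod_(0 <= j < k) (1 + z ^+ (2 ^ j * (a + b)))) + 1 != 0.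
Proof.
move=> z1; apply/negP => /eqP.
have powz1 n : `|z ^+ n| <= 1 by rewrite normrX exprn_ile1.
under eq_bigr => j _ do rewrite mulnC exprM exprD.
move: (powz1 a) (powz1 b); set x := z ^+ a; set y := z ^+ b => x1 y1.
set S := \prod_(_ <= _ < _) _ => /eqP; rewrite addr_eq0 => /eqP E.
have N1 : -1 != 0 :> C by rewrite oppr_eq0 oner_neq0.
have [x0 y0] : 1 + x != 0 /\ 1 + y != 0.
  by move: N1; rewrite -E !mulf_eq0 !negb_or => /andP[/andP[]].
have tele : (1 - x * y) * S = 1 - (x * y) ^+ (2 ^ k).
  exact: prod_1DX_exp2_telescope.
have E1 : (1 + x) * (1 + y) * (1 - (x * y) ^+ (2 ^ k)) = - (1 - x * y).
  by rewrite -tele mulrCA E mulrN1.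
have W1 : (x * y) ^+ (2 ^ k) = 1.
  apply: unit_disk_eq1 x1 y1 _ x0 y0 E1.
  by rewrite -exprD -exprM powz1.
have w1 : x * y = 1.
  by move/eqP: E1; rewrite W1 subrr mulr0 eq_sym oppr_eq0 subr_eq0 => /eqP.
have : 0 <= -1 :> C.
  rewrite -E mulr_ge0 ?mul_1D_ge0 // prodr_ge0 // => j _.
  by rewrite w1 expr1n addr_ge0.
by rewrite oppr_ge0 ler10.
Qed.

End UnitDisk.

Lemma monic_1DXn (R : nzRingType) n : (0 < n)%N -> 1 + 'X^n \is @monic R.
Proof. by move=> n0; rewrite addrC -polyC1 monicXnaddC. Qed.

Local Open Scope complex_scope.

Theorem mainTheorem17 (R : realType) (a b k : nat)
    (ha : (0 < a)%N) (hb : (0 < b)%N) (hk : (0 < k)%N) :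
  let P : {poly R[i]} :=
    (1 + 'X^a) * (1 + 'X^b)
      * (\prod_(0 <= j < k.+1) (1 + 'X^(2 ^ j * (a + b))%N)) + 1 in
  [/\ integer_poly P, expanding P, lead_coef P = 1
    & P`_0 = 2 \/ P`_0 = - 2].
Proof.
move=> P.
have pow_gt0 j : (0 < 2 ^ j * (a + b))%N by rewrite muln_gt0 expn_gt0 addn_gt0 ha.
split.
- pose Q : {poly int} := (1 + 'X^a) * (1 + 'X^b)
      * (\prod_(0 <= j < k.+1) (1 + 'X^(2 ^ j * (a + b))%N)) + 1.
  have -> : P = map_poly intr Q.
    rewrite !(rmorphD, rmorphM, rmorph1, rmorph_prod) /= !map_polyXn.
    by under [in RHS]eq_bigr => j _ do rewrite rmorphD rmorph1 /= map_polyXn.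
  by move=> i; exists Q`_i; rewrite coef_map.
- move=> z /rootP; rewrite !hornerE horner_prod.
  under eq_bigr => j _ do rewrite !hornerE.
  move=> Pz; rewrite real_ltNge ?realE ?normr_ge0 ?ler01 //.
  by apply/negP => /(@no_root_in_unit_disk _ z a b k.+1)/eqP.
- rewrite /P; set G := \prod_(_ <= _ < _) _.
  have Gm : (1 + 'X^b) * G \is monic.
    by rewrite monicMl ?monic_1DXn // monic_prod // => j _; exact: monic_1DXn.
  rewrite -mulrA lead_coefDl; first by apply/monicP; rewrite monicMl ?monic_1DXn.
  rewrite size_poly1 size_Mmonic ?monic_neq0 ?monic_1DXn //.
  rewrite addrC -polyC1 size_XnaddC // addSn /=.
  have := monic_neq0 Gm; rewrite -size_poly_gt0; case: size => // n _.
  by rewrite addnS ltnS addn_gt0 ha.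
- left; rewrite -horner_coef0 !hornerE horner_prod big1 => [|j _].
    by rewrite !expr0n !gtn_eqF // !addr0 !mulr1.
  by rewrite !hornerE expr0n gtn_eqF // addr0.
Qed.
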